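(* Let $W$ be a well labelled spider obtained by performing operation R1 or operation R2 (once) on a thin spider $G=(S,C,H)$. Then $\gamma_{\{R2\}}(W)= \gamma_{\{R2\}}(G)=|S|+1$.
   Context: All graphs are finite, undirected and simple. For a graph $G=(V,E)$, a function $f:V\to\{0,1,2\}$ is a Roman $\{2\}$-dominating function of $G$ if for every $v\in V$ with $f(v)=0$, either $v$ has a neighbor $u$ with $f(u)=2$, or $v$ has two distinct neighbors $x,y$ with $f(x)=f(y)=1$. The weight of $f$ is $\sum_{v\in V}f(v)$, and $\gamma_{\{R2\}}(G)$ is the minimum weight of a Roman $\{2\}$-dominating function of $G$. A thin spider with spider partition $(S,C,H)$ is a graph whose vertex set is partitioned into $S,C,H$ ($H$ possibly empty), where $S=\{s_1,\ldots,s_r\}$ is a stable set and $C=\{c_1,\ldots,c_r\}$ is a clique, $r\geq 2$, every vertex of $H$ is adjacent to every vertex of $C$ and to no vertex of $S$, and $s_i$ is adjacent to $c_j$ if and only if $i=j$; the edges $s_ic_i$ are its legs. Replacing a vertex $v$ by a graph $F$ means deleting $v$, adding a disjoint copy of $F$, and joining every vertex of $F$ to every neighbor of $v$ (when two adjacent vertices are replaced, all edges between the two replacing graphs are present). A well labelled spider is a graph obtained from a thin spider $(S,C,H)$ by performing one of the following operations once: R1: replace one vertex $v\in S$ by a graph with three vertices; R2: replace both endpoints of one leg by graphs with two vertices; R3: replace at most one endpoint of every leg by a graph with two vertices. *)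

(* Defs.v *)
From mathcomp Require Import all_boot.

Set Implicit Arguments.
Unset Strict Implicit.
Unset Printing Implicit Defensive.

Record sgraph := SGraph {
  vertex :> finType;
  adj : rel vertex;
  adj_sym : symmetric adj;
  adj_irr : irreflexive adj }.

Definition graph_iso (G W : sgraph) : Prop :=
  exists2 h : G -> W, bijective h & forall x y, adj (h x) (h y) = adj x y.

Definition stable (G : sgraph) (A : {set G}) : Prop :=
  {in A &, forall x y, ~~ adj x y}.

Definition clique (G : sgraph) (A : {set G}) : Prop :=
  {in A &, forall x y, x != y -> adj x y}.

Definition roman2_dominating (G : sgraph) (f : {ffun G -> 'I_3}) : bool :=
  [forall v, (f v == 0 :> nat) ==>
     [exists u, adj v u && (f u == 2 :> nat)]
  || [exists x, exists y,
        [&& x != y, adj v x, adj v y, f x == 1 :> nat & f y == 1 :> nat]]].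

Definition weight (G : sgraph) (f : {ffun G -> 'I_3}) : nat := \sum_v f v.

Lemma roman2_dominating_max (G : sgraph) :
  roman2_dominating [ffun _ : G => ord_max].
Proof. by apply/forallP=> v; rewrite ffunE. Qed.

(* The minimum is attained: [roman2_dominating_max] shows that the set over
   which it is taken contains the default value of [arg min], the constant
   function 2. *)
Definition gammaR2 (G : sgraph) : nat :=
  weight [arg min_(f < [ffun _ : G => ord_max] | roman2_dominating f) weight f].

(* The subgraph induced by [H] is arbitrary, and [H] may be empty. *)
Definition thin_spider (G : sgraph) (S C H : {set G}) : Prop :=
  [/\ S :|: C :|: H = [set: G],
      [&& [disjoint S & C], [disjoint S & H] & [disjoint C & H]],
      stable S /\ clique C,
      {in H, forall h, {in C, forall c, adj h c} /\
                       {in S, forall s, ~~ adj h s}}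
    & exists r (s c : 'I_r -> G),
        [/\ 2 <= r,
            injective s /\ injective c,
            S = [set s i | i : 'I_r],
            C = [set c i | i : 'I_r]
          & forall i j, adj (s i) (c j) = (i == j)]].

(* In a thin spider the edges between [S] and [C] are exactly the s_i c_i. *)
Definition leg (G : sgraph) (S C : {set G}) (x y : G) : bool :=
  [&& x \in S, y \in C & adj x y].

Section Replace.
Variables (G : sgraph) (v : G) (F : sgraph).

Definition replace_vertex : finType := ({x : G | x != v} + F)%type.

Definition replace_adj (a b : replace_vertex) : bool :=
  match a, b with
  | inl x, inl y => adj (val x) (val y)
  | inl x, inr _ => adj (val x) v
  | inr _, inl y => adj v (val y)
  | inr x, inr y => adj x y
  end.

Lemma replace_adj_sym : symmetric replace_adj.
Proof. by move=> [x|x] [y|y] /=; apply: adj_sym. Qed.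

Lemma replace_adj_irr : irreflexive replace_adj.
Proof. by move=> [x|x] /=; apply: adj_irr. Qed.

Definition replace : sgraph := SGraph replace_adj_sym replace_adj_irr.

Definition kept (x : G) (xv : x != v) : replace :=
  inl (exist (fun x => x != v) x xv).

End Replace.

Definition obtained_by_R1 (G : sgraph) (S : {set G}) (W : sgraph) : Prop :=
  exists (v : G) (F : sgraph),
    [/\ v \in S, #|F| = 3 & graph_iso (replace v F) W].

(* Replacing [x] and then the surviving copy of [y] puts all edges between
   [Fx] and [Fy], since [x] and [y] are adjacent. *)
Definition obtained_by_R2 (G : sgraph) (S C : {set G}) (W : sgraph) : Prop :=
  exists (x y : G) (yx : y != x) (Fx Fy : sgraph),
    [/\ leg S C x y, #|Fx| = 2, #|Fy| = 2
      & graph_iso (replace (@kept G x Fx y yx) Fy) W].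

(* Main.v *)
Require Import Defs.
From mathcomp Require Import all_boot.

Set Implicit Arguments.
Unset Strict Implicit.
Unset Printing Implicit Defensive.

(** R1 and R2 both make [W] a blow-up of [G]: a map [p : W -> G] such that
    vertices in distinct fibres are adjacent exactly when their images are. Let
    [s_0 c_0] be the leg being modified.

    Lower bound: all neighbours of a vertex over [s_i] lie over [s_i] or [c_i],
    so the vertices over the [i]-th leg have total weight at least 1, and at
    least 2 if the fibre of [s_0] has two vertices and [i = 0]. For [G] itself,
    if no [s_i] has value 0 then the domination of [c_0] forces one more unit.

    Upper bound: give total weight 2 to the fibre of [c_0], evenly spread (2 on
    one vertex or 1 on each of two), and 1 to each [s_i] with [i != 0]; every
    remaining vertex is adjacent to the whole fibre of [c_0]. *)

(** * Minimum weight and lower bounds for sums *)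

Lemma gammaR2_eq (G : sgraph) n (f : {ffun G -> 'I_3}) :
    roman2_dominating f -> weight f = n ->
    (forall g : {ffun G -> 'I_3}, roman2_dominating g -> n <= weight g) ->
  gammaR2 G = n.
Proof.
move=> domf wf lb; rewrite /gammaR2.
case: arg_minnP => [|g domg ming]; first exact: roman2_dominating_max.
by apply/eqP; rewrite eqn_leq lb // andbT -wf ming.
Qed.

Lemma leq_sum_set1 (T : finType) (A : {set T}) (F : T -> nat) x :
  x \in A -> F x <= \sum_(y in A) F y.
Proof. by move=> xA; rewrite (bigD1 x) //= leq_addr. Qed.

Lemma leq_sum_set2 (T : finType) (A : {set T}) (F : T -> nat) x y :
  x \in A -> y \in A -> x != y -> F x + F y <= \sum_(z in A) F z.
Proof.
move=> xA yA xy; rewrite (bigD1 x) //= (bigD1 y) /= ?yA 1?eq_sym //.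
by rewrite addnA leq_addr.
Qed.

Lemma roman2_neighbours (G : sgraph) (f : {ffun G -> 'I_3}) (A : {set G}) v :
    roman2_dominating f -> (forall u, adj v u -> u \in A) ->
  f v = 0 :> nat -> 2 <= \sum_(u in A) f u.
Proof.
move=> /forallP/(_ v) domf sA fv0; move: domf; rewrite fv0 /=.
case/orP=> [/existsP[u /andP[vu /eqP fu]]|].
  have := leq_sum_set1 (fun z => f z : nat) (sA u vu).
  by rewrite fu.
case/existsP=> x /existsP[y] /and5P[xy vx vy /eqP fx /eqP fy].
have := leq_sum_set2 (fun z => f z : nat) (sA x vx) (sA y vy) xy.
by rewrite fx fy.
Qed.

(** Each of the [r] disjoint sets pays one unit and the set at [i0] pays a second one. The sets need
    not cover [T]. *)
Lemma leq_sum_disjoint (T : finType) r (P : 'I_r -> {set T}) (F : T -> nat) i0 :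
    (forall i j, i != j -> [disjoint P i & P j]) ->
    (forall i, 1 <= \sum_(x in P i) F x) -> 2 <= \sum_(x in P i0) F x ->
  r + 1 <= \sum_x F x.
Proof.
move=> dP P1 P2; apply: (@leq_trans (\sum_(x in \bigcup_i P i) F x)); last first.
  by rewrite [leqRHS](bigID (mem (\bigcup_i P i))) leq_addr.
rewrite partition_disjoint_bigcup // (bigD1 i0) //= addn1.
(* The index [i0] witnesses [0 < r], so the indices other than [i0] number exactly [r.-1]. *)
have -> : r.+1 = 2 + \sum_(i < r | i != i0) 1.
  by rewrite sum1_card cardC1 card_ord !addSn add0n (ltn_predK (ltn_ord i0)).
by apply: leq_add => //; apply: leq_sum.
Qed.

(** * Legs of a thin spider *)

Definition spider_legs {G : sgraph} {r} (s c : 'I_r -> G) : Prop :=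
  [/\ injective s, injective c, forall i j, s i != c j,
      forall i x, adj (s i) x = (x == c i)
    & forall i x, x != c i -> (forall j, x = s j -> j = i) -> adj (c i) x].

(** The last clause of [spider_legs] merges the clique [C] with the complete join between [C] and
    [H], so that [H] can be forgotten from here on. *)
Lemma thin_spider_legs (G : sgraph) (S C H : {set G}) : thin_spider S C H ->
  exists r (s c : 'I_r -> G),
    [/\ 0 < r, spider_legs s c, S = [set s i | i : 'I_r]
      & C = [set c i | i : 'I_r]].
Proof.
case=> covG /and3P[dSC _ _] [stS clC] adjH [r [s [c [r2 [injs injc] eS eC sc]]]].
exists r, s, c; split=> //; first exact: ltnW.
have sS i : s i \in S by rewrite eS imset_f.
have cC i : c i \in C by rewrite eC imset_f.
have cover x : [|| x \in S, x \in C | x \in H].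
  by rewrite orbA -!in_setU covG inE.
split=> // [i j|i x|i x xc xs].
- by apply: contraTneq (cC j) => <-; rewrite (disjointFr dSC).
- apply/idP/eqP=> [sx|->]; last by rewrite sc.
  case/or3P: (cover x) => [xS|xC|xH].
  + by case/negP: (stS _ _ (sS i) xS).
  + by move: xC sx; rewrite eC => /imsetP[j _ ->]; rewrite sc => /eqP->.
  + by case/negP: ((adjH _ xH).2 _ (sS i)); rewrite adj_sym.
- case/or3P: (cover x) => [xS|xC|xH].
  + move: xS xs; rewrite eS => /imsetP[j _ ->] /(_ j erefl) ->.
    by rewrite adj_sym sc.
  + by apply: clC; rewrite // eq_sym.
  + by rewrite adj_sym; apply: (adjH _ xH).1.
Qed.

Lemma spider_leg (G : sgraph) r (s c : 'I_r -> G) x y :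
    spider_legs s c ->
    leg [set s i | i : 'I_r] [set c i | i : 'I_r] x y ->
  exists i, x = s i /\ y = c i.
Proof.
case=> _ injc _ adjs _ /and3P[/imsetP[i _ ->] /imsetP[j _ ->]].
by rewrite adjs => /eqP/injc->; exists i.
Qed.

(** * Replacement as a blow-up *)

Definition blowup {W G : sgraph} (p : W -> G) : Prop :=
  forall a b, p a != p b -> adj a b = adj (p a) (p b).

Definition fibre {W G : sgraph} (p : W -> G) (x : G) : {set W} :=
  [set a | p a == x].

(** Distinct images under the composite force distinct images under [q], so both conditions apply in
    turn. Edges inside a fibre stay unconstrained, as the replacing graphs are arbitrary. *)
Lemma blowup_comp (V W G : sgraph) (q : V -> W) (p : W -> G) :
  blowup q -> blowup p -> blowup (p \o q).
Proof.
move=> bq bp a b /= pq; rewrite bq ?bp //.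
by apply: contraNneq pq => ->.
Qed.

(** The fibres of [q] are compared only above [z], because the second replacement of R2 has fibres
    of different sizes. *)
Lemma card_fibre_comp (V W G : sgraph) (q : V -> W) (p : W -> G) z n :
    (forall w, p w = z -> #|fibre q w| = n) ->
  #|fibre (p \o q) z| = #|fibre p z| * n.
Proof.
move=> fq; rewrite -sum1_card.
rewrite (partition_big q (mem (fibre p z))) /= => [|a]; last by rewrite !inE.
rewrite -sum_nat_const; apply: eq_bigr => w; rewrite inE => /eqP pw.
rewrite -(fq w pw) -sum1_card; apply: eq_bigl => a; rewrite !inE /=.
by apply: andb_idl => /eqP->; rewrite pw.
Qed.

Lemma graph_iso_blowup (G W : sgraph) : graph_iso G W ->
  exists2 g : W -> G, blowup g & forall x, #|fibre g x| = 1.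
Proof.
case=> h [g hK gK] adjh; exists g => [a b _|x]; first by rewrite -adjh !gK.
apply/eqP/cards1P; exists (h x); apply/setP=> a; rewrite !inE.
by apply/eqP/eqP=> [<-|->].
Qed.

Definition replace_proj {G : sgraph} {v : G} {F : sgraph} (a : replace v F) : G :=
  match a with inl x => val x | inr _ => v end.

Lemma blowup_replace (G : sgraph) (v : G) (F : sgraph) :
  blowup (@replace_proj G v F).
Proof. by case=> [a|a] [b|b] //=; rewrite eqxx. Qed.

Lemma card_fibre_replace (G : sgraph) (v : G) (F : sgraph) :
  #|fibre (@replace_proj G v F) v| = #|F|.
Proof.
have inr_inj : injective (inr : F -> replace v F) by move=> a b [].
rewrite -(card_imset predT inr_inj); apply: eq_card => a.
apply/idP/imsetP=> [|[b _ ->]]; last by rewrite inE /=.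
by case: a => [[a av]|b]; rewrite inE /= ?(negPf av) //; exists b.
Qed.

Lemma fibre_replace_kept (G : sgraph) (v : G) (F : sgraph) x (xv : x != v) :
  fibre (@replace_proj G v F) x = [set @kept G v F x xv].
Proof.
apply/setP=> a; rewrite !inE; apply/eqP/eqP=> [|->//].
case: a => [[a av]|b] /= ax; last by case/eqP: (xv).
by congr inl; apply: val_inj.
Qed.

Lemma R1_blowup (G W : sgraph) (v : G) (F : sgraph) :
    graph_iso (replace v F) W ->
  exists p : W -> G, [/\ blowup p, #|fibre p v| = #|F|
    & forall x, x != v -> #|fibre p x| = 1].
Proof.
case/graph_iso_blowup=> g bg fg; exists (replace_proj \o g); split.
- exact: blowup_comp bg (@blowup_replace _ _ _).
- by rewrite (card_fibre_comp (n := 1)) // card_fibre_replace muln1.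
- move=> x xv; rewrite (card_fibre_comp (n := 1)) //.
  by rewrite (fibre_replace_kept F xv) cards1.
Qed.

(** The first projection has only the kept copy above [y], and that copy is what [Fy] replaces.
    Above any other vertex the second replacement leaves the size of the fibre unchanged. *)
Lemma R2_blowup (G W : sgraph) (x y : G) (yx : y != x) (Fx Fy : sgraph) :
    graph_iso (replace (@kept G x Fx y yx) Fy) W ->
  exists p : W -> G, [/\ blowup p, #|fibre p x| = #|Fx|, #|fibre p y| = #|Fy|
    & forall z, z != x -> z != y -> #|fibre p z| = 1].
Proof.
case/R1_blowup=> q [bq fqy fq]; exists (replace_proj \o q).
have fib z : z != y ->
    #|fibre (replace_proj \o q) z| = #|fibre (@replace_proj G x Fx) z|.
  move=> zy; rewrite (card_fibre_comp (n := 1)) ?muln1 // => w wz.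
  by apply: fq; apply: contraNneq zy => wy; rewrite -wz wy.
split.
- exact: blowup_comp bq (@blowup_replace _ _ _).
- by rewrite fib 1?eq_sym // card_fibre_replace.
- rewrite (card_fibre_comp (n := #|Fy|)) => [|w wy].
    by rewrite (fibre_replace_kept Fx yx) cards1 mul1n.
  have : w \in fibre replace_proj y by rewrite inE wy.
  by rewrite (fibre_replace_kept Fx yx) inE => /eqP->.
- by move=> z zx zy; rewrite fib // (fibre_replace_kept Fx zx) cards1.
Qed.

(** * Lower bounds *)

Definition leg_fibre {W G : sgraph} (p : W -> G) {r} (s c : 'I_r -> G) i : {set W} :=
  fibre p (s i) :|: fibre p (c i).

Lemma leg_fibre_disjoint (W G : sgraph) (p : W -> G) r (s c : 'I_r -> G) i j :
  spider_legs s c -> i != j -> [disjoint leg_fibre p s c i & leg_fibre p s c j].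
Proof.
case=> injs injc sc _ _; apply: contraR => /pred0Pn[a /=]; rewrite !inE.
case/andP=> /orP[]/eqP-> /orP[]; rewrite ?(inj_eq injs) ?(inj_eq injc) //.
  by rewrite (negPf (sc _ _)).
by rewrite eq_sym (negPf (sc _ _)).
Qed.

Lemma leg_fibre_sum0 (W G : sgraph) (p : W -> G) r (s c : 'I_r -> G) i a
    (f : {ffun W -> 'I_3}) :
    spider_legs s c -> blowup p -> roman2_dominating f ->
    p a = s i -> f a = 0 :> nat ->
  2 <= \sum_(b in leg_fibre p s c i) f b.
Proof.
case=> _ _ _ adjs _ bp domf pa; apply: roman2_neighbours => // b ab.
(* A neighbour of [a] outside the fibre of [s i] projects to a neighbour of [s i], which can only be
   [c i]. *)
rewrite !inE; case: eqVneq => //= pb.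
by rewrite -adjs -pa -bp // pa eq_sym.
Qed.

Lemma leg_fibre_sum1 (W G : sgraph) (p : W -> G) r (s c : 'I_r -> G) i a
    (f : {ffun W -> 'I_3}) :
    spider_legs s c -> blowup p -> roman2_dominating f -> p a = s i ->
  1 <= \sum_(b in leg_fibre p s c i) f b.
Proof.
move=> lsc bp domf pa; case: (posnP (f a)) => [fa0|fa].
  exact: ltnW (leg_fibre_sum0 lsc bp domf pa fa0).
apply: leq_trans fa _; apply: (leq_sum_set1 (fun b => f b : nat)).
by rewrite !inE pa eqxx.
Qed.

Lemma weight_blowup_ge (W G : sgraph) (p : W -> G) r (s c : 'I_r -> G) i0
    (f : {ffun W -> 'I_3}) :
    spider_legs s c -> blowup p -> (forall i, 0 < #|fibre p (s i)|) ->
    2 <= #|fibre p (s i0)| -> roman2_dominating f ->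
  r + 1 <= weight f.
Proof.
move=> lsc bp fs fs0 domf.
apply: (leq_sum_disjoint (P := leg_fibre p s c) (i0 := i0)).
- by move=> i j; apply: leg_fibre_disjoint.
- move=> i; have /card_gt0P[a] := fs i; rewrite inE => /eqP pa.
  exact: leg_fibre_sum1 pa.
case/card_gt1P: fs0 => a [b []]; rewrite !inE => /eqP pa /eqP pb ab.
case: (posnP (f a)) => [|fa]; first exact: leg_fibre_sum0 pa.
case: (posnP (f b)) => [|fb]; first exact: leg_fibre_sum0 pb.
apply: leq_trans (leq_add fa fb) _.
by apply: (leq_sum_set2 (fun b => f b : nat)); rewrite // !inE ?pa ?pb eqxx.
Qed.

(** If some [s i] has value 0, its leg carries weight 2, the identity being a blow-up. Otherwise the
    extra unit comes from [c i0], whose dominators may lie in other legs or in [H], so the vertices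
    have to be grouped differently. *)
Lemma weight_spider_ge (G : sgraph) r (s c : 'I_r -> G) (f : {ffun G -> 'I_3}) :
  0 < r -> spider_legs s c -> roman2_dominating f -> r + 1 <= weight f.
Proof.
move=> r0 lsc domf; have bid : blowup (@id G) by [].
have [injs injc sc adjs _] := lsc.
case: (pickP (fun i => f (s i) == 0 :> nat)) => [i /eqP fi|fs].
  apply: (leq_sum_disjoint (P := leg_fibre id s c) (i0 := i)).
  - by move=> k j; apply: leg_fibre_disjoint.
  - by move=> k; apply: (leg_fibre_sum1 lsc bid domf erefl).
  - exact: (leg_fibre_sum0 lsc bid domf erefl fi).
have {}fs i : 0 < f (s i) by rewrite lt0n fs.
pose i0 := Ordinal r0.
(* The other [s i] are positive and form singleton groups. Everything else goes into [rest], which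
   contains [c i0] and all its neighbours, since [s i0] is the only [s j] adjacent to [c i0]. *)
pose rest := ~: [set s i | i in [set~ i0]].
have restP x : (forall j, x = s j -> j = i0) -> x \in rest.
  move=> xs; rewrite inE; apply/imsetP=> -[j]; rewrite !inE => ji xj.
  by rewrite (xs j xj) eqxx in ji.
have si0 : s i0 \in rest by apply: restP => j /injs.
have srest j : j != i0 -> [disjoint rest & [set s j]].
  by move=> ji; rewrite disjoint_sym disjoints1 inE negbK imset_f ?inE.
apply: (leq_sum_disjoint (P := fun i => if i == i0 then rest else [set s i]) (i0 := i0)).
- move=> i j; case: (eqVneq i i0) => [->|ii0]; case: (eqVneq j i0) => [_|ji0] //.
  + by move=> _; apply: srest.
  + by move=> _; rewrite disjoint_sym; apply: srest.
  + by move=> ij; rewrite disjoints1 inE (inj_eq injs).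
- move=> i; case: eqVneq => _; last by rewrite big_set1.
  exact: leq_trans (fs i0) (leq_sum_set1 (fun x => f x : nat) si0).
(* Either [c i0] has value 0 and its neighbours bring 2 to [rest], or [s i0] and [c i0] bring at
   least 1 each. *)
rewrite eqxx; case: (posnP (f (c i0))) => [|fc].
  apply: roman2_neighbours => // u cu; apply: restP => j uj.
  by move: cu; rewrite uj adj_sym adjs => /eqP/injc.
apply: leq_trans (leq_add (fs i0) fc) _.
apply: (leq_sum_set2 (fun x => f x : nat)); rewrite ?sc //.
by apply: restP => j /eqP; rewrite eq_sym (negPf (sc _ _)).
Qed.

(** * Upper bound *)

Lemma blowup_dominating (W G : sgraph) (p : W -> G) r (s c : 'I_r -> G) i0 :
    spider_legs s c -> blowup p ->
    (forall i, i != i0 -> #|fibre p (s i)| = 1) ->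
    #|fibre p (c i0)| \in [:: 1; 2] ->
  exists2 f : {ffun W -> 'I_3}, roman2_dominating f & weight f = r + 1.
Proof.
case=> injs _ sc _ adjc bp fs fc; set T := [set s i | i in [set~ i0]].
(* The value [k] makes the total over the fibre of [c i0] equal to 2 for either fibre size. *)
pose k := if #|fibre p (c i0)| == 1 then 2 else 1.
pose g x := if x == c i0 then k else x \in T.
have g3 x : g x < 3.
  by rewrite /g /k; case: (x == c i0); [case: ifP | case: (x \in T)].
exists [ffun a => Ordinal (g3 (p a))].
  apply/forallP=> a; rewrite !ffunE /=; apply/implyP=> /eqP ga.
  have pac : p a != c i0.
    by apply: contra_eqN ga => /eqP pa; rewrite pa /g eqxx /k; case: ifP.
  (* A vertex of value 0 lies neither over [c i0] nor over an [s j] with [j != i0], so its image is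
     adjacent to [c i0]. *)
  have adja b : p b = c i0 -> adj a b.
    move=> pb; rewrite bp pb // adj_sym; apply: adjc => // j paj.
    apply/eqP; apply: contra_eqT ga => ji.
    by rewrite /g (negPf pac) paj imset_f ?inE.
  apply/orP; move: fc; rewrite !inE => /orP[|] fc.
    left; have /cards1P[b fb] := fc; have : b \in fibre p (c i0) by rewrite fb inE.
    rewrite inE => /eqP pb; apply/existsP; exists b.
    by rewrite adja // ffunE /= /g /k pb fc eqxx.
  right; have /cards2P[b [d [bd fbd]]] := fc.
  have : b \in fibre p (c i0) by rewrite fbd !inE eqxx.
  have : d \in fibre p (c i0) by rewrite fbd !inE eqxx orbT.
  rewrite !inE => /eqP pd /eqP pb; apply/existsP; exists b; apply/existsP; exists d.
  by rewrite bd !adja // !ffunE /= /g /k pb pd (eqP fc) eqxx.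
have kfc : #|fibre p (c i0)| * k = 2.
  by rewrite /k; move: fc; rewrite !inE => /orP[]/eqP->.
transitivity (\sum_x #|fibre p x| * g x).
  rewrite /weight (partition_big p xpredT) //=; apply: eq_bigr => x _.
  rewrite -sum_nat_const; apply: eq_big => [a|a /eqP <-]; first by rewrite inE.
  by rewrite ffunE.
have cT : c i0 \notin T.
  by apply/imsetP=> -[i _] /eqP; rewrite eq_sym (negPf (sc _ _)).
(* The term at [c i0] is 2, each of the [r.-1] vertices of [T] adds 1 because its fibre is a
   singleton, and all other terms vanish. *)
rewrite (bigD1 (c i0)) //= {1}/g eqxx kfc (bigID (mem T)) /=.
rewrite [X in _ + (_ + X)]big1 => [|x /andP[xc xT]]; last first.
  by rewrite /g (negPf xc) (negPf xT) muln0.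
rewrite (eq_bigl [in T]) => [|x]; last first.
  by apply: andb_idl => xT; apply: contraNneq cT => <-.
rewrite (eq_bigr (fun=> 1)) => [|x /= xT]; last first.
  rewrite /g xT; case: eqVneq => [xc|_]; first by rewrite -xc xT in cT.
  by move: xT => /imsetP[i]; rewrite !inE => ii0 ->; rewrite fs.
rewrite sum1_card card_imset // cardsC1 card_ord addn0 addn1 !addSn add0n.
by rewrite (ltn_predK (ltn_ord i0)).
Qed.

(** * Exact values for the blow-up and for the spider *)

Lemma gammaR2_blowup (W G : sgraph) (p : W -> G) r (s c : 'I_r -> G) i0 :
    spider_legs s c -> blowup p -> 2 <= #|fibre p (s i0)| ->
    #|fibre p (c i0)| \in [:: 1; 2] ->
    (forall x, x != s i0 -> x != c i0 -> #|fibre p x| = 1) ->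
  gammaR2 W = r + 1.
Proof.
move=> lsc bp fs0 fc fx; have [injs _ sc _ _] := lsc.
have fs i : i != i0 -> #|fibre p (s i)| = 1.
  by move=> ii0; apply: fx; rewrite ?sc ?(inj_eq injs).
have [f domf wf] := blowup_dominating lsc bp fs fc.
apply: gammaR2_eq domf wf _ => g; apply: (weight_blowup_ge lsc bp _ fs0) => i.
by case: (eqVneq i i0) => [->|/fs->//]; apply: ltnW.
Qed.

Lemma gammaR2_spider (G : sgraph) r (s c : 'I_r -> G) :
  0 < r -> spider_legs s c -> gammaR2 G = r + 1.
Proof.
move=> r0 lsc; have bid : blowup (@id G) by [].
have fid x : #|fibre (@id G) x| = 1.
  by apply/eqP/cards1P; exists x; apply/setP=> y; rewrite !inE.
have [] := blowup_dominating lsc bid (i0 := Ordinal r0) (fun i _ => fid _).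
  by rewrite fid.
by move=> f domf wf; apply: gammaR2_eq domf wf _ => g; apply: weight_spider_ge lsc.
Qed.

Theorem proposition3p4 (G : sgraph) (S C H : {set G}) (W : sgraph) :
  thin_spider S C H ->
  obtained_by_R1 S W \/ obtained_by_R2 S C W ->
  gammaR2 W = gammaR2 G /\ gammaR2 G = #|S| + 1.
Proof.
case/thin_spider_legs=> r [s [c [r0 lsc -> ->]]] WG.
have [injs injc sc _ _] := lsc.
rewrite card_imset // card_ord (gammaR2_spider r0 lsc); split=> //.
(* Over the ends [s i] and [c i] of the modified leg, R1 gives fibres of sizes 3 and 1, and R2 gives
   sizes 2 and 2. *)
case: WG => [[v [F [/imsetP[i _ ->] F3 /R1_blowup[p [bp fs fx]]]]]|].
  apply: (gammaR2_blowup lsc bp (i0 := i)) => //; first by rewrite fs F3.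
    by rewrite fx // eq_sym.
  by move=> x xs _; apply: fx.
case=> x [y [yx [Fx [Fy [xy Fx2 Fy2 /R2_blowup[p [bp fx fy fz]]]]]]].
have [i [xi yi]] := spider_leg lsc xy; subst x y.
by apply: (gammaR2_blowup lsc bp (i0 := i)) => //; rewrite ?fx ?fy ?Fx2 ?Fy2.
Qed.
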